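(* Let $n \ge 2$ and let $A^{(n)}=\{a_1,\ldots,a_n\}$ be a set with $n$ elements. Then the set-graph $G_{A^{(n)}}$ has an odd number of vertices.
   Context: For a set $A^{(n)}=\{a_1,\ldots,a_n\}$ of $n$ distinct elements, the set-graph $G_{A^{(n)}}$ is the simple undirected graph whose vertices are in bijection with the non-empty subsets of $A^{(n)}$, two distinct vertices being adjacent if and only if the corresponding subsets have non-empty intersection. *)

(* Defs.v *)
From HB Require Import structures.
From mathcomp Require Import all_boot.

Set Implicit Arguments.
Unset Strict Implicit.
Unset Printing Implicit Defensive.

Record sgraph := SGraph {
  vertex : finType;
  adj : rel vertex;
  adj_sym : symmetric adj;
  adj_irrefl : irreflexive adj }.

Section SetGraph.
Variables (T : finType) (A : {set T}).

(* The bijection between vertices and non-empty subsets is taken to be the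
   identity: a vertex is a non-empty subset of A. *)
Definition set_vertex := {S : {set T} | (S \subset A) && (S != set0)}.

Definition set_adj : rel set_vertex :=
  [rel u v : set_vertex | (u != v) && (val u :&: val v != set0)].

Fact set_adj_sym : symmetric set_adj.
Proof. by move=> u v; rewrite /set_adj /= eq_sym setIC. Qed.

Fact set_adj_irrefl : irreflexive set_adj.
Proof. by move=> u; rewrite /set_adj /= eqxx. Qed.

Definition set_graph : sgraph := SGraph set_adj_sym set_adj_irrefl.

End SetGraph.

(* Main.v *)
Require Import Defs.
From mathcomp Require Import all_boot.

(** Discarding the empty set from the powerset leaves [2 ^ n - 1] vertices, and a positive power of
    2 is even. *)

Lemma card_set_graph (T : finType) (A : {set T}) :
  #|vertex (set_graph A)| = (2 ^ #|A|).-1.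
Proof.
(* Splitting [set0] off the powerset contributes a 1 that cancels the predecessor. *)
rewrite /= card_sig -card_powerset (cardsD1 set0) powersetE sub0set /=.
by apply: eq_card => S; rewrite !inE andbC.
Qed.

Theorem proposition2p2 (n : nat) (hn : 2 <= n) (T : finType) (A : {set T})
  (hA : #|A| = n) : odd #|vertex (set_graph A)|.
Proof.
rewrite card_set_graph hA -subn1 oddB ?expn_gt0 // oddX.
(* [oddX] leaves the disjunct [n == 0], the case [2 ^ 0 = 1], which [hn] excludes. *)
by case: n hn {hA}.
Qed.
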